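(* For every integer $k\ge 2$, the set $\mathcal{IC}_{\rm fin}(C^k(S))$ of functions $f\in C^k(S)$ whose corresponding family $F_{r,a}:x\mapsto x+2\pi r+a f(x) \pmod{2\pi}$ has finite infinitesimal cyclicity is $\sigma$-porous in $C^k(S)$.
   Context: Let $S=\mathbb{R}/2\pi\mathbb{Z}$. $C^k(S)$ is the Banach space of real-valued $2\pi$-periodic $C^k$ functions with the usual $C^k$ norm. Let $X$ be a normed linear space and $B(x,r)=\{y\in X:\|y-x\|<r\}$. A subset $E$ of $X$ is porous at $x$ if there is $c>0$ such that for any $\epsilon>0$ there is $y\in X$ with $0<\|y-x\|<\epsilon$ and $B(y,c\|y-x\|)\cap E=\emptyset$. A subset $E\subset X$ is porous if it is porous at every $x\in E$. A subset is $\sigma$-porous if it is a union of countably many porous sets. For a function $f$ on $S$, the corresponding family is $F_{r,a}:S\to S$, $x\mapsto x+2\pi r+a f(x) \pmod{2\pi}$, where $r\in\mathbb{R}$ and $a$ ranges over a small interval $[-a_0,a_0]$ on which these maps are circle diffeomorphisms. For a circle diffeomorphism $g$, $N(g)$ is the number of attracting periodic trajectories of $g$ and $\rho(g)$ is the rotation number of $g$ (normalized so that $x\mapsto x+2\pi r$ has rotation number $r$). Define $$B(F,\rho_0)=\limsup_{a_1\to 0+}\ \sup_{\rho(F_{r,a})=\rho_0,\ |a|<a_1} N(F_{r,a}).$$ The family $F$ has finite infinitesimal cyclicity if $B(F,\rho)$ is uniformly bounded over all $\rho\in\mathbb{R}$. *)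

(* Defs.v *)
From HB Require Import structures.
From mathcomp Require Import all_boot all_order all_algebra.
From mathcomp Require Import all_classical all_reals all_analysis.

Set Implicit Arguments.
Unset Strict Implicit.
Unset Printing Implicit Defensive.

Import Order.TTheory GRing.Theory Num.Theory.
Import numFieldNormedType.Exports.

Local Open Scope classical_set_scope.
Local Open Scope ring_scope.

Section Porosity.
Context {R : realType} {X : normedModType R}.
Implicit Types E : set X.

Definition porous_at E (x : X) : Prop :=
  exists2 c : R, 0 < c & forall e : R, 0 < e ->
    exists y : X, 0 < `|y - x| < e /\ ball y (c * `|y - x|) `&` E = set0.

Definition porous E : Prop := forall x, E x -> porous_at E x.

Definition sigma_porous E : Prop :=
  exists2 P : nat -> set X, (forall n, porous (P n)) & E = \bigcup_n P n.

End Porosity.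

Section CkCircle.
Context {R : realType}.
Implicit Types (k : nat) (f g : R -> R).

Definition is_Ck_circle k f : Prop :=
  [/\ periodic f (2 * pi),
      forall i x, (i < k)%N -> derivable (derive1n i f) x 1
    & continuous (derive1n k f)].

Lemma derive1n_lin k (a : R) f g i : is_Ck_circle k f -> is_Ck_circle k g ->
  (i <= k)%N ->
  derive1n i (fun x => a * f x + g x) =
  fun x => a * derive1n i f x + derive1n i g x.
Proof.
move=> [_ df _] [_ dg _]; elim: i => [//|i IH] ik.
rewrite !derive1nS (IH (ltnW ik)); apply/funext => x.
have dfx := df _ x ik; have dgx := dg _ x ik.
rewrite !derive1E.
have -> : (fun x => a * derive1n i f x + derive1n i g x) =
  (a *: (derive1n i f : R -> R^o) + (derive1n i g : R -> R^o)) by [].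
by rewrite deriveD ?deriveZ//; exact: derivableZ.
Qed.

Lemma is_Ck_circle_lin k (a : R) f g : is_Ck_circle k f -> is_Ck_circle k g ->
  is_Ck_circle k (fun x => a * f x + g x).
Proof.
move=> cf cg; have [pf df kf] := cf; have [pg dg kg] := cg; split.
- by move=> x; rewrite pf pg.
- move=> i x ik; rewrite (derive1n_lin a cf cg (ltnW ik)).
  apply: derivableD; last exact: dg.
  exact: (@derivableZ _ _ _ (derive1n i f : R -> R^o) a x 1 (df _ _ ik)).
- rewrite (derive1n_lin a cf cg (leqnn k)) => x.
  by apply: cvgD; [apply: cvgM; [exact: cvg_cst|exact: kf]|exact: kg].
Qed.

Lemma derive1n0 i : derive1n i (fun=> 0 : R) = (fun=> 0) :> (R -> R).
Proof.
elim: i => // i IH; rewrite derive1nS IH; apply/funext => x.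
by rewrite derive1E derive_cst.
Qed.

Lemma is_Ck_circle0 k : is_Ck_circle k (fun=> 0).
Proof.
split=> // [i x _|]; first by rewrite derive1n0; exact: derivable_cst.
by rewrite derive1n0; exact: cst_continuous.
Qed.

Lemma Ck_circle_continuous k f i : is_Ck_circle k f -> (i <= k)%N ->
  continuous (derive1n i f).
Proof.
move=> [_ df kf]; rewrite leq_eqVlt => /predU1P[->//|ik] x.
by apply: differentiable_continuous; apply/derivable1_diffP; exact: df.
Qed.

Lemma periodic_derive1n f i (T : R) : periodic f T -> periodic (derive1n i f) T.
Proof.
move=> pf; elim: i => // i IH x.
rewrite derive1nS !derive1E /derive; rewrite IH.
by under eq_fun do rewrite /= addrA IH.
Qed.

Lemma periodic_bounded f : periodic f (2 * pi) -> continuous f ->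
  exists M, forall x, `|f x| <= M.
Proof.
move=> pf cf; have T0 : 0 < 2 * pi :> R by rewrite mulr_gt0 ?pi_gt0.
have cc : compact (f @` `[0, 2 * pi]).
  apply: continuous_compact; last exact: segment_compact.
  by move=> x; apply: continuous_subspaceT.
have [M [_ bM]] := compact_bounded cc.
have Mb y : 0 <= y <= 2 * pi -> `|f y| <= M + 1.
  move=> y01; have M1 : M < M + 1 by rewrite ltrDl.
  apply: (bM (M + 1) M1); by exists y; rewrite //= in_itv.
have pfn (n : nat) y : f (y + n%:R * (2 * pi)) = f y.
  by rewrite mulr_natl; exact: periodicn.
have pfz (z : int) y : f (y + z%:~R * (2 * pi)) = f y.
  case: z => n; first by rewrite -pmulrn pfn.
  by rewrite NegzE mulrNz mulNr -[LHS](pfn n.+1) pmulrn subrK.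
exists (M + 1) => x; rewrite -(pfz (- Num.floor (x / (2 * pi))) x) Mb//.
have := floor_itv (x / (2 * pi)).
rewrite ler_pdivlMr// ltr_pdivrMr// => /andP[lx xu].
rewrite mulrNz mulNr subr_ge0 lx/= lerBlDr.
by move: (ltW xu); rewrite intrD mulrDl mul1r addrC.
Qed.

Lemma Ck_circle_has_sup k f i : is_Ck_circle k f -> (i <= k)%N ->
  has_sup (range (fun x => `|derive1n i f x|)).
Proof.
move=> cf ik; split; first by exists `|derive1n i f 0|, 0.
have [pf _ _] := cf.
have [M Mf] := periodic_bounded (periodic_derive1n i pf)
  (Ck_circle_continuous cf ik).
by exists M => _ [x _ <-].
Qed.

End CkCircle.

(* R^o is R viewed as a module over itself, which makes R -> R^o an R-module. *)
Definition Ck_circle (R : realType) (k : nat) : {pred R -> R^o} :=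
  mem [set f : R -> R | is_Ck_circle k f].
Arguments Ck_circle : clear implicits.

Lemma Ck_circle_submod_closed (R : realType) k : submod_closed (Ck_circle R k).
Proof.
split; first by rewrite inE; exact: is_Ck_circle0.
by move=> a f g; rewrite !inE => cf cg; exact: is_Ck_circle_lin.
Qed.

HB.instance Definition _ (R : realType) k :=
  GRing.isSubmodClosed.Build R (R -> R^o) (Ck_circle R k)
    (@Ck_circle_submod_closed R k).

Record Ck (R : realType) (k : nat) := CkSub {
  Ck_fun :> R -> R^o;
  Ck_funP : Ck_fun \in Ck_circle R k }.
Arguments Ck : clear implicits.

HB.instance Definition _ (R : realType) k := [isSub for @Ck_fun R k].
HB.instance Definition _ (R : realType) k := [Choice of Ck R k by <:].
HB.instance Definition _ (R : realType) k := [SubChoice_isSubLmodule of Ck R k by <:].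

Section CkNorm.
Context {R : realType} {k : nat}.
Implicit Types f g : Ck R k.

Definition Ck_norm f : R :=
  \big[Num.max/0]_(i < k.+1) sup (range (fun x : R => `|derive1n i f x|)).

Lemma CkP f : is_Ck_circle k f.
Proof. by have := Ck_funP f; rewrite inE. Qed.

Lemma Ck_norm_ge0 f : 0 <= Ck_norm f.
Proof. exact: bigmax_ge_id. Qed.

Lemma le_Ck_norm f i x : (i <= k)%N -> `|derive1n i f x| <= Ck_norm f.
Proof.
move=> ik; have ik1 : (i < k.+1)%N by [].
apply: le_trans (le_bigmax _ _ (Ordinal ik1)) => /=.
by apply: ub_le_sup; [exact: (Ck_circle_has_sup (CkP f) ik).2|exists x].
Qed.

Lemma Ck_norm_le f (M : R) : 0 <= M ->
  (forall i x, (i <= k)%N -> `|derive1n i f x| <= M) -> Ck_norm f <= M.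
Proof.
move=> M0 fM; apply: bigmax_le => // i _; apply: ge_sup.
  by exists `|derive1n i f 0|, 0.
by move=> _ [x _ <-]; apply: fM; rewrite -ltnS.
Qed.

Lemma derive1n_CkD f g i : (i <= k)%N ->
  derive1n i (f + g : Ck R k) = fun x => derive1n i f x + derive1n i g x.
Proof.
move=> ik; have := derive1n_lin 1 (CkP f) (CkP g) ik.
by under eq_fun do rewrite mul1r; move=> ->; under eq_fun do rewrite mul1r.
Qed.

Lemma derive1n_CkZ (a : R) f i : (i <= k)%N ->
  derive1n i (a *: f : Ck R k) = fun x => a * derive1n i f x.
Proof.
move=> ik; have := derive1n_lin a (CkP f) (is_Ck_circle0 k) ik.
under eq_fun do rewrite addr0; move=> ->.
by rewrite derive1n0; under eq_fun do rewrite addr0.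
Qed.

Lemma ler_Ck_normD f g : Ck_norm (f + g) <= Ck_norm f + Ck_norm g.
Proof.
apply: Ck_norm_le => [|i x ik]; first by rewrite addr_ge0 ?Ck_norm_ge0.
rewrite derive1n_CkD//; apply: le_trans (ler_normD _ _) _.
by rewrite lerD ?le_Ck_norm.
Qed.

Lemma Ck_normZ (a : R) f : Ck_norm (a *: f) = `|a| * Ck_norm f.
Proof.
have le_norm (b : R) h : Ck_norm (b *: h) <= `|b| * Ck_norm h.
  apply: Ck_norm_le => [|i x ik]; first by rewrite mulr_ge0 ?Ck_norm_ge0.
  by rewrite derive1n_CkZ// normrM ler_wpM2l ?le_Ck_norm.
apply/eqP; rewrite eq_le le_norm/=.
have [->|a0] := eqVneq a 0; first by rewrite normr0 mul0r Ck_norm_ge0.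
rewrite -ler_pdivlMl ?normr_gt0// -normfV.
by apply: le_trans (le_norm _ _); rewrite scalerA mulVf// scale1r.
Qed.

Lemma Ck_norm0_eq0 f : Ck_norm f = 0 -> f = 0.
Proof.
move=> f0; apply/val_inj/funext => x /=.
by apply/eqP; rewrite -normr_le0 -f0; exact: (le_Ck_norm f x (leq0n k)).
Qed.

End CkNorm.

HB.instance Definition _ (R : realType) k :=
  Lmodule_isNormed.Build R (Ck R k) (@ler_Ck_normD R k) (@Ck_normZ R k)
    (@Ck_norm0_eq0 R k).

Section Circle.
Context {R : realType}.
Implicit Types (x y : R) (G : R -> R).

(* A circle map is given by a lift G : R -> R commuting with the translation by
   2 * pi; points and subsets of S are given by representatives in R and by
   their (2 * pi)-invariant preimages in R. *)
Definition eq_circle x y : Prop := exists m : int, x = y + m%:~R * (2 * pi).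

Definition dist_circle x y : R :=
  inf (range (fun m : int => `|x - y + m%:~R * (2 * pi)|)).

Definition periodic_point G x : Prop :=
  exists2 q : nat, (0 < q)%N & eq_circle (iter q G x) x.

Definition trajectory G x : set R :=
  [set y | exists n : nat, eq_circle y (iter n G x)].

(* Asymptotic stability for the metric of S. Lyapunov stability is required in
   addition to attraction: if g has a unique fixed point and it is semi-stable,
   then every trajectory of g in S converges to that point. *)
Definition attracting_point G x : Prop :=
  (forall e : R, 0 < e -> exists2 d : R, 0 < d &
     forall y, dist_circle y x < d ->
     forall n, dist_circle (iter n G y) (iter n G x) < e) /\
  (exists2 d : R, 0 < d & forall y, dist_circle y x < d ->
     dist_circle (iter n G y) (iter n G x) @[n --> \oo] --> (0 : R)).

Definition attracting_trajectories G : set (set R) :=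
  [set trajectory G x | x in [set x | periodic_point G x /\
                                      attracting_point G x]].

(* Equal to +oo when there are infinitely many attracting trajectories. *)
Definition nb_attracting G : \bar R := counting (attracting_trajectories G).

(* For an increasing lift G the limit exists and does not depend on the starting
   point; the lift x + 2 * pi * r has rotation number r. *)
Definition rotation_number G : R :=
  lim (iter n G 0 / (n%:R * (2 * pi)) @[n --> \oo]).

End Circle.

Section Cyclicity.
Context {R : realType}.
Implicit Types (f : R -> R).

(* The canonical lift of the circle map. For f of class C^1 it is a
   diffeomorphism once `|a| * sup |f'| < 1, so that the limit for a1 --> 0+ below
   only involves diffeomorphisms. *)
Definition rot_family f (r a : R) : R -> R := fun x => x + 2 * pi * r + a * f x.

Definition cyclicity_bound f (rho0 : R) : \bar R :=
  limf_esup
    (fun a1 : R => ereal_sup [set nb_attracting (rot_family f p.1 p.2) |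
       p in [set p : R * R | rotation_number (rot_family f p.1 p.2) = rho0 /\
                             `|p.2| < a1]])
    0^'+.

Definition finite_infinitesimal_cyclicity f : Prop :=
  exists M : R, forall rho : R, (cyclicity_bound f rho <= M%:E)%E.

Definition IC_fin k : set (Ck R k) :=
  [set f | finite_infinitesimal_cyclicity f].

End Cyclicity.
Arguments IC_fin : clear implicits.

(* Main.v *)
Require Import Defs.
From mathcomp Require Import all_boot all_reals.
From mathcomp Require Import all_order all_algebra all_classical all_analysis.
From mathcomp Require Import ring lra.

(* Averaging over the rotation by 2 pi / q turns f into the sum of its
   Fourier modes of frequency divisible by q, which governs the first order in
   a of the q-th iterate of F_(1/q + a b, a): up to 2 pi, it moves x by
   a (S x + q b) + o(a) with S x = sum_(j < q) f (x + 2 pi j / q).  Hence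
   descending simple zeros of S + q b yield attracting periodic orbits of
   rotation number 1/q for all small a > 0.

   For g of class C^k, the sums of g^(k) over q equally spaced points are o(q),
   because they are Riemann sums of a derivative of a periodic function.  As S is
   (2 pi / q)-periodic, integrating k times shows that S oscillates by
   o(q (2 pi / q)^k), whereas the wave delta sin (q m x) of C^k norm e, with
   delta = e / (q m)^k, contributes q delta sin (q m x).  For q large this wave
   dominates, even after a further perturbation of C^k norm c e with c
   depending only on m and k, and produces m attracting orbits.  So the functions
   whose cyclicity bounds are all at most n form a porous set (take m = n + 1). *)

Set Implicit Arguments.
Unset Strict Implicit.
Unset Printing Implicit Defensive.

Import Order.TTheory GRing.Theory Num.Theory.
Import numFieldNormedType.Exports.

Local Open Scope classical_set_scope.
Local Open Scope ring_scope.

(** * Periodic functions: oscillation, zeros of derivatives, uniform continuity *)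

Section PeriodicFunctions.
Context {R : realType}.
Implicit Types (f g dg : R -> R) (T B x y : R).

Lemma periodic_int f T : periodic f T ->
  forall (m : int) x, f (x + m%:~R * T) = f x.
Proof.
move=> pf; have pfn (n : nat) y : f (y + n%:R * T) = f y.
  by rewrite mulr_natl; exact: periodicn.
case=> n x; first by rewrite -pmulrn pfn.
by rewrite NegzE mulrNz mulNr -[LHS](pfn n.+1) pmulrn subrK.
Qed.

Lemma reduce_mod T x : 0 < T -> exists m : int, 0 <= x + m%:~R * T <= T.
Proof.
move=> T0; exists (- Num.floor (x / T)).
have := floor_itv (x / T); rewrite ler_pdivlMr// ltr_pdivrMr// => /andP[lx xu].
rewrite mulrNz mulNr subr_ge0 lx/= lerBlDr.
by move: (ltW xu); rewrite intrD mulrDl mul1r addrC.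
Qed.

(** The point [c] lies between [x] and [y]; recording only its distance to [y] gives one form for
    both orders of [x] and [y]. *)
Lemma MVT_unordered g dg x y : (forall z, is_derive z (1:R) g (dg z)) ->
  exists2 c, `|c - y| <= `|x - y| & g x - g y = dg c * (x - y).
Proof.
move=> gd; have gc a b : {within `[a, b], continuous g}.
  apply: continuous_subspaceT => z; apply: differentiable_continuous.
  by apply/derivable1_diffP; case: (gd z).
have [xy|yx] := leP x y.
  have [c] := MVT_segment xy (fun z _ => gd z) (gc _ _).
  rewrite in_itv /= => /andP[xc cy] E; exists c; last by lra.
  by rewrite !ler0_norm; lra.
have [c] := MVT_segment (ltW yx) (fun z _ => gd z) (gc _ _).
rewrite in_itv /= => /andP[xc cy] E; exists c; last by lra.
by rewrite !ger0_norm; lra.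
Qed.

Lemma derive_lipschitz g dg B : (forall z, is_derive z (1:R) g (dg z)) ->
  (forall z, `|dg z| <= B) -> forall x y, `|g x - g y| <= B * `|x - y|.
Proof.
move=> gd dB x y; have [c _ ->] := MVT_unordered x y gd.
by rewrite normrM ler_wpM2r.
Qed.

(** An integer shift brings [x] into [[y, y + T]], where the derivative bound acts over a length of
    at most [T]. *)
Lemma periodic_osc T g dg B : 0 < T -> periodic g T ->
  (forall z, is_derive z (1:R) g (dg z)) -> (forall z, `|dg z| <= B) ->
  forall x y, `|g x - g y| <= T * B.
Proof.
move=> T0 pg gd dB x y; have [m /andP[m0 mT]] := reduce_mod (x - y) T0.
rewrite -(periodic_int pg m x); apply: le_trans (derive_lipschitz gd dB _ _) _.
rewrite mulrC ler_wpM2r//; first exact: le_trans (dB 0).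
by rewrite addrAC ger0_norm.
Qed.

Lemma periodic_derive_zero T g dg : 0 < T -> periodic g T ->
  (forall z, is_derive z (1:R) g (dg z)) -> exists z, dg z = 0.
Proof.
move=> T0 pg gd; have [c _ E] := MVT_unordered T 0 gd.
exists c; apply/eqP; move: E; rewrite subr0 -[T in g T]add0r pg subrr => /eqP.
by rewrite eq_sym mulf_eq0 (gt_eqF T0) orbF.
Qed.

Lemma periodic_unif_continuous f T : 0 < T -> periodic f T -> continuous f ->
  forall e : R, 0 < e -> exists2 d, 0 < d &
    forall x y, `|x - y| < d -> `|f x - f y| < e.
Proof.
move=> T0 pf cf e e0.
(* Compactness of [[0, T]], with the radius as the parameter tending to [0+]. Only [x] is confined
   to the segment while [y] is any real, so a single shift can finally move both points. *)
have /compact_near_coveringP ncov := @segment_compact R 0 T.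
have [] := ncov _ (0 : R)^'+ (fun d x =>
  forall y, `|x - y| < d -> `|f x - f y| < e) _.
  move=> x _; have := cf x; move/cvgrPdist_lt => /(_ (e / 2)) [|d /= d0 fd].
    by rewrite divr_gt0.
  exists ([set z | `|x - z| < d / 2], [set z | 0 < z < d / 2]) => /=.
    split; first by exists (d / 2) => //=; rewrite divr_gt0.
    exists (d / 2) => /=; first by rewrite divr_gt0.
    move=> z /=; rewrite sub0r normrN => zd z0; rewrite z0/=.
    by apply: le_lt_trans zd; exact: ler_norm.
  move=> [z d'] /= [xz /andP[d'0 d'd]] y zy.
  have -> : f z - f y = (f x - f y) - (f x - f z) by lra.
  apply: le_lt_trans (ler_normB _ _) _; rewrite [e]splitr.
  apply: ltrD; apply: fd => /=; last by lra.
  have -> : x - y = (x - z) + (z - y) by lra.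
  by apply: le_lt_trans (ler_normD _ _) _; lra.
move=> d0 /= d00 H; exists (d0 / 2) => [|x y xy]; first by rewrite divr_gt0.
have [m m0T] := reduce_mod x T0.
rewrite -(periodic_int pf m x) -(periodic_int pf m y).
apply: (H (d0 / 2)) => //=.
- by rewrite sub0r normrN gtr0_norm; lra.
- by lra.
- by have -> : x + m%:~R * T - (y + m%:~R * T) = x - y by lra.
Qed.

End PeriodicFunctions.

(** * Sums over the rotation by 2 pi / q *)

Section RotationSums.
Context {R : realType}.
Implicit Types (f g dg : R -> R) (q : nat) (x y B : R).

Definition angle q : R := 2 * pi / q%:R.

Definition rot_sum q g x : R := \sum_(j < q) g (x + j%:R * angle q).

Lemma twopi_gt0 : 0 < 2 * pi :> R.
Proof. by rewrite mulr_gt0 ?pi_gt0. Qed.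

Lemma angle_gt0 q : (0 < q)%N -> 0 < angle q.
Proof. by move=> q0; rewrite divr_gt0 ?twopi_gt0 ?ltr0n. Qed.

Lemma mul_angle q : (0 < q)%N -> q%:R * angle q = 2 * pi.
Proof. by move=> q0; rewrite /angle mulrC divfK// pnatr_eq0 -lt0n. Qed.

Lemma rot_sum_telescope q g x : (0 < q)%N -> periodic g (2 * pi) ->
  \sum_(j < q) (g (x + j.+1%:R * angle q) - g (x + j%:R * angle q)) = 0.
Proof.
move=> q0 pg.
have -> : \sum_(j < q) (g (x + j.+1%:R * angle q) - g (x + j%:R * angle q)) =
    \sum_(0 <= j < q) (g (x + j.+1%:R * angle q) - g (x + j%:R * angle q)).
  by rewrite big_mkord.
rewrite (telescope_sumr (fun j => g (x + j%:R * angle q)))//.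
by rewrite mul_angle// pg mul0r addr0 subrr.
Qed.

Lemma rot_sum_periodic q g : (0 < q)%N -> periodic g (2 * pi) ->
  periodic (rot_sum q g) (angle q).
Proof.
move=> q0 pg x; apply/eqP; rewrite -subr_eq0 /rot_sum -sumrB.
apply/eqP; rewrite -[RHS](rot_sum_telescope x q0 pg).
by apply: eq_bigr => j _; rewrite -addrA -nat1r mulrDl mul1r.
Qed.

Lemma is_derive_rot_sum q g dg : (forall z, is_derive z (1 : R) g (dg z)) ->
  forall z, is_derive z (1 : R) (rot_sum q g) (rot_sum q dg z).
Proof.
move=> gd z; rewrite /rot_sum.
have -> : (fun x => \sum_(j < q) g (x + j%:R * angle q)) =
    \sum_(j < q) (fun x => g (x + j%:R * angle q)).
  by apply/funext => x; rewrite fct_sumE.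
apply: is_derive_sum => j.
have E : is_derive z (1 : R) (fun x => x + j%:R * angle q) 1.
  by apply: is_derive_eq; rewrite addr0.
have := gd (z + j%:R * angle q) => H.
have := @is_derive1_comp _ g _ z _ _ H E.
by rewrite mulr1.
Qed.

Lemma rot_sum_le q g B : (forall z, `|g z| <= B) ->
  forall z, `|rot_sum q g z| <= q%:R * B.
Proof.
move=> gB z; apply: le_trans (ler_norm_sum _ _ _) _.
apply: le_trans (ler_sum _ (fun j _ => gB _)) _.
by rewrite sumr_const card_ord mulr_natl.
Qed.

Lemma rot_sumD q f g x :
  rot_sum q (fun z => f z + g z) x = rot_sum q f x + rot_sum q g x.
Proof. by rewrite /rot_sum big_split. Qed.

(* Each value of the derivative differs little from a difference quotient of
   step [angle q], and these telescope along the orbit. *)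
Lemma rot_sum_derive_le q g dg (eta : R) : (0 < q)%N -> periodic g (2 * pi) ->
  (forall z, is_derive z (1 : R) g (dg z)) ->
  (forall x y, `|x - y| <= angle q -> `|dg x - dg y| <= eta) ->
  forall z, `|rot_sum q dg z| <= q%:R * eta.
Proof.
move=> q0 pg gd dgc z; have a0 := angle_gt0 q0.
pose u (j : 'I_q) := z + j%:R * angle q.
have -> : rot_sum q dg z = \sum_(j < q) (dg (u j) -
    (g (z + j.+1%:R * angle q) - g (u j)) / angle q).
  rewrite sumrB -mulr_suml (rot_sum_telescope z q0 pg) mul0r subr0.
  by [].
apply: le_trans (ler_norm_sum _ _ _) _.
suff H j : `|dg (u j) - (g (z + j.+1%:R * angle q) - g (u j)) / angle q| <= eta.
  apply: le_trans (ler_sum _ (fun j _ => H j)) _.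
  by rewrite sumr_const card_ord mulr_natl.
have uE : z + j.+1%:R * angle q - u j = angle q.
  by rewrite /u -nat1r; ring.
have [c] := MVT_unordered (z + j.+1%:R * angle q) (u j) gd.
rewrite uE (gtr0_norm a0) => cu ->; rewrite mulfK ?gt_eqF//.
by apply: dgc; rewrite distrC.
Qed.

(** For [i > 0] the sum for the [i]-th derivative is itself the derivative of a periodic function,
    the sum of order [i - 1]. It vanishes somewhere, so its oscillation over a period [angle q]
    bounds it, and each step down in [i] gains a factor [angle q]. *)
Lemma rot_sum_derive1n_le k q f B : (0 < q)%N -> is_Ck_circle k f ->
  (forall z, `|rot_sum q (derive1n k f) z| <= B) ->
  forall i, (0 < i <= k)%N -> forall z,
    `|rot_sum q (derive1n i f) z| <= angle q ^+ (k - i) * B.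
Proof.
move=> q0 [pf df _] kB i /andP[i0 ik]; have a0 := angle_gt0 q0.
have fd j z : (j < k)%N -> is_derive z (1 : R) (derive1n j f) (derive1n j.+1 f
  z).
  by move=> jk; rewrite derive1nS derive1E; apply/derivableP; exact: df.
have Sd j : (j < k)%N -> forall z, is_derive z (1 : R)
    (rot_sum q (derive1n j f)) (rot_sum q (derive1n j.+1 f) z).
  by move=> jk; apply: is_derive_rot_sum => z; exact: fd.
have Sp j := rot_sum_periodic q0 (periodic_derive1n j pf).
suff H n : (n < k)%N -> forall z,
    `|rot_sum q (derive1n (k - n) f) z| <= angle q ^+ n * B.
  by move=> z; have := H (k - i)%N; rewrite subKn//; apply;
    rewrite ltn_subrL i0 (leq_trans i0).
elim: n => [|n IH] nk z; first by rewrite subn0 expr0 mul1r.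
have jk : (k - n.+1 < k)%N by rewrite ltn_subrL (leq_ltn_trans _ nk).
have jE : (k - n.+1).+1 = (k - n)%N by rewrite (subnSK (ltnW nk)).
have [|z0 z00] := periodic_derive_zero a0 (Sp (k - n.+1).-1)
    (dg := rot_sum q (derive1n (k - n.+1) f)).
  have := Sd _ (leq_ltn_trans (leq_pred _) jk).
  by rewrite prednK ?subn_gt0.
rewrite -[rot_sum _ _ z]subr0 -z00 exprS -mulrA.
apply: (periodic_osc a0 (Sp _) (Sd _ jk)) => y.
by rewrite jE; exact: IH (ltnW nk) y.
Qed.

(** The sum of [f] itself may have a nonzero mean, so the last integration bounds only its
    oscillation. *)
Lemma rot_sum_osc_le k q f B : (0 < k)%N -> (0 < q)%N -> is_Ck_circle k f ->
  (forall z, `|rot_sum q (derive1n k f) z| <= B) ->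
  forall x y, `|rot_sum q f x - rot_sum q f y| <= angle q ^+ k * B.
Proof.
move=> k0 q0 cf kB x y; have [pf df _] := cf.
rewrite -(prednK k0) exprS -mulrA -subn1.
apply: (@periodic_osc _ _ _ (rot_sum q (derive1n 1 f))).
- exact: angle_gt0.
- exact: rot_sum_periodic.
- apply: is_derive_rot_sum => z; rewrite derive1n1 derive1E.
  by apply/derivableP; exact: (df 0).
- exact: (rot_sum_derive1n_le q0 cf kB).
Qed.

End RotationSums.

(** * Sine waves and their rotation sums *)

Section Sine.
Context {R : realType}.
Implicit Types (d x : R) (N q m k : nat).

Definition sine_wave d N : R -> R := fun x => d * sin (N%:R * x).

Lemma sinDint2pi x (m : int) : sin (x + m%:~R * (2 * pi)) = sin x.
Proof. by apply: periodic_int => y; rewrite mulr_natl sinD2pi. Qed.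

(** Differentiation is written as a phase shift by [pi / 2], a form that iterates to all orders. *)
Lemma is_derive_sine_phase d N (p : R) x :
  is_derive x (1 : R) (fun x => d * sin (N%:R * x + p))
    (d * N%:R * sin (N%:R * x + p + pi / 2)).
Proof.
have E : is_derive x (1 : R) (fun x => N%:R * x + p) N%:R.
  by apply: is_derive_eq; rewrite /GRing.scale /= addr0 mulr1.
have H : is_derive (N%:R * x + p) (1 : R) (fun x => d * sin x)
    (d * cos (N%:R * x + p)).
  exact: is_derive_eq.
have := @is_derive1_comp _ (fun x => d * sin x) _ x _ _ H E.
by rewrite sinDpihalf mulrAC.
Qed.

Lemma derive1n_sine_wave d N i : derive1n i (sine_wave d N) =
  fun x => d * N%:R ^+ i * sin (N%:R * x + i%:R * (pi / 2)).
Proof.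
elim: i => [|i IH]; first by apply/funext => x; rewrite expr0 mulr1 mul0r addr0.
rewrite derive1nS IH; apply/funext => x; rewrite derive1E.
have [_ ->] := is_derive_sine_phase (d * N%:R ^+ i) N (i%:R * (pi / 2)) x.
by rewrite exprSr [d * (_ * _)]mulrA -[i.+1%:R]natr1 [(i%:R + 1) * _]mulrDl
  mul1r addrA.
Qed.

Lemma is_Ck_sine_wave d N k : is_Ck_circle k (sine_wave d N).
Proof.
split.
- move=> x; rewrite /sine_wave mulrDr.
  by rewrite (_ : N%:R * (2 * pi) = N%:~R * (2 * pi))// sinDint2pi.
- move=> i x _; rewrite derive1n_sine_wave.
  by have [] := is_derive_sine_phase (d * N%:R ^+ i) N (i%:R * (pi / 2)) x.
- move=> x; apply: differentiable_continuous; apply/derivable1_diffP.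
  rewrite derive1n_sine_wave.
  by have [] := is_derive_sine_phase (d * N%:R ^+ k) N (k%:R * (pi / 2)) x.
Qed.

(** The frequency is a multiple of [q]: the [j]-th rotation changes the phase by [j * m] full turns,
    so all [q] terms agree. *)
Lemma rot_sum_sine q m d (p x : R) : (0 < q)%N ->
  rot_sum q (fun x => d * sin ((q * m)%:R * x + p)) x =
  q%:R * d * sin ((q * m)%:R * x + p).
Proof.
move=> q0; rewrite /rot_sum.
have E (j : 'I_q) : sin ((q * m)%:R * (x + j%:R * angle q) + p) =
    sin ((q * m)%:R * x + p).
  rewrite -[RHS](sinDint2pi _ (j * m)%N); congr sin.
  by rewrite -(mul_angle q0) -pmulrn !natrM; ring.
under eq_bigr do rewrite E.
by rewrite sumr_const card_ord -[RHS]mulrA [RHS]mulr_natl.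
Qed.

Lemma derive1n_sine_wave_le d N i x : 0 <= d ->
  `|derive1n i (sine_wave d N) x| <= d * N%:R ^+ i.
Proof.
move=> d0; rewrite derive1n_sine_wave normrM.
have D0 : 0 <= d * N%:R ^+ i by rewrite mulr_ge0// exprn_ge0.
rewrite (ger0_norm D0) ler_piMr// ler_norml.
exact/andP/(conj (sin_geN1 _) (sin_le1 _)).
Qed.

End Sine.

Lemma counting_ge (R : realType) (T : choiceType) (A : set T) m
    (g : 'I_m -> T) : injective g -> (forall i, A (g i)) ->
  ((m%:R : R)%:E <= counting A)%E.
Proof.
move=> gI gA; rewrite /counting; case: ifPn => [/asboolP fA|_];
  last exact: leey.
rewrite lee_fin ler_nat -[m in (m <= _)%N]size_enum_ord -(size_map g).
apply: uniq_leq_size; first by rewrite map_inj_uniq ?enum_uniq.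
by move=> _ /mapP[i _ ->]; rewrite in_fset_set// inE.
Qed.

(** * Lifts of circle maps: rotation number and attracting orbits *)

Section CircleLifts.
Context {R : realType}.
Implicit Types (G : R -> R) (x y : R) (n q : nat).

Lemma iter_shift G : (forall x, G (x + 2 * pi) = G x + 2 * pi) ->
  forall n (z : int) x,
    iter n G (x + z%:~R * (2 * pi)) = iter n G x + z%:~R * (2 * pi).
Proof.
move=> G1 n; have pn : periodic (fun x => iter n G x - x) (2 * pi).
  move=> x; suff -> : iter n G (x + 2 * pi) = iter n G x + 2 * pi by lra.
  by elim: n => //= n ->.
by move=> z x; have /= := periodic_int pn z x; lra.
Qed.

Lemma iter_periodic_orbit G q x :
  (forall x, G (x + 2 * pi) = G x + 2 * pi) -> iter q G x = x + 2 * pi ->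
  forall s, iter (s * q) G x = x + s%:R * (2 * pi).
Proof.
move=> G1 Gx; elim=> [|s IH]; first by rewrite mul0r addr0.
have := iter_shift G1 q s x; rewrite -pmulrn => E.
by rewrite mulSn iterD IH E Gx -addrA -[s.+1%:R]nat1r [(1 + _) * _]mulrDl mul1r.
Qed.

(** Each block of [q] steps moves [x] by exactly [2 * pi], that is [q] angles, so the drift at time
    [n] is the drift at time [n %% q]. *)
Lemma iter_drift_le G q x (D : R) : (0 < q)%N ->
  (forall x, G (x + 2 * pi) = G x + 2 * pi) -> iter q G x = x + 2 * pi ->
  (forall j, (j < q)%N -> `|iter j G x - (x + j%:R * angle q)| <= D) ->
  forall n, `|iter n G x - (x + n%:R * angle q)| <= D.
Proof.
move=> q0 G1 Gx Dj n; have := Dj _ (ltn_pmod n q0).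
have := iter_shift G1 (n %% q) (n %/ q)%N x; rewrite -pmulrn => E.
rewrite {3 4}(divn_eq n q) [(n %/ q * q + _)%N]addnC iterD.
rewrite (iter_periodic_orbit G1 Gx) E natrD natrM.
suff -> : iter (n %% q) G x + (n %/ q)%:R * (2 * pi) -
    (x + ((n %% q)%:R + (n %/ q)%:R * q%:R) * angle q) =
    iter (n %% q) G x - (x + (n %% q)%:R * angle q) by [].
by rewrite -(mul_angle q0); ring.
Qed.

(** The orbit of [x] stays at bounded distance from a rigid rotation. By monotonicity the orbit of 0
    is squeezed between those of two translates of [x] that are [2 * pi] apart. *)
Lemma rotation_numberE G q x : (0 < q)%N -> {homo G : x y / x <= y} ->
  (forall x, G (x + 2 * pi) = G x + 2 * pi) -> iter q G x = x + 2 * pi ->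
  rotation_number G = q%:R^-1.
Proof.
move=> q0 Gm G1 Gx; have P0 := @twopi_gt0 R.
have im n : {homo iter n G : x y / x <= y}.
  by elim: n => //= n IH y z yz; apply: Gm; exact: IH.
pose D := \sum_(j < q) `|iter j G x - (x + j%:R * angle q)|.
have xD n : `|iter n G x - (x + n%:R * angle q)| <= D.
  apply: iter_drift_le => // j jq.
  by rewrite /D (bigD1 (Ordinal jq))//= lerDl sumr_ge0.
have [m /andP[m0 m1]] := reduce_mod (- x) P0.
pose C := D + 2 * pi.
have bC n : `|iter n G 0 - n%:R * angle q| <= C.
  have l : x + (- m)%:~R * (2 * pi) <= 0 by rewrite mulrNz mulNr; lra.
  have r : 0 <= x + (1 - m)%:~R * (2 * pi).
    by rewrite intrB [(_ - _) * _]mulrBl mul1r; lra.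
  have := im n _ _ l; have := im n _ _ r; rewrite !(iter_shift G1).
  rewrite intrB [(_ - _) * _]mulrBl mul1r mulrNz mulNr; have := xD n.
  by rewrite !ler_norml /C; lra.
apply/cvg_lim => //; apply/cvgrPdist_le => e e0; near=> n.
have n0 : 0 < n%:R :> R by near: n; exact: nbhs_infty_gtr.
have E (s t p v : R) : s != 0 -> t != 0 -> p != 0 ->
    s^-1 - v / (t * p) = - (v - t * (p / s)) / (t * p).
  by move=> s0 t0 p0; field; rewrite s0 t0 p0.
rewrite E ?gt_eqF// ?ltr0n// -/(angle q).
rewrite normrM normrN normfV [`|_ * (2 * pi)|]gtr0_norm ?mulr_gt0 ?pi_gt0//.
rewrite ler_pdivrMr ?mulr_gt0 ?pi_gt0//; apply: le_trans (bC n) _.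
rewrite mulrCA -ler_pdivrMr ?mulr_gt0 ?pi_gt0//; apply: ltW.
by near: n; exact: nbhs_infty_gtr.
Unshelve. all: by end_near.
Qed.

Lemma dist_circle_ge0 x y : 0 <= dist_circle x y.
Proof. by apply: lb_le_inf => [|_ [m _ <-]//];
  exists `|x - y + 0%:~R * (2 * pi)|, 0. Qed.

Lemma dist_circle_le x y (m : int) :
  dist_circle x y <= `|x - y + m%:~R * (2 * pi)|.
Proof. by apply: ge_inf; [exists 0 => _ [i _ <-]|exists m]. Qed.

Lemma dist_circle_lt x y (d : R) : dist_circle x y < d ->
  exists m : int, `|x + m%:~R * (2 * pi) - y| < d.
Proof.
move=> /inf_lt [|_ [m _ <-] xyd];
  first by exists `|x - y + 0%:~R * (2 * pi)|, 0.
by exists m; rewrite addrAC.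
Qed.

(** Among [n] steps, the [n %/ q] full blocks contract by [l] each, and the fewer than [q] remaining
    steps expand by at most [L ^+ q]. *)
Lemma contraction_attracting G q x (L l d0 : R) : (0 < q)%N ->
  (forall x, G (x + 2 * pi) = G x + 2 * pi) -> iter q G x = x + 2 * pi ->
  1 <= L -> (forall y z, `|G y - G z| <= L * `|y - z|) ->
  0 <= l < 1 -> 0 < d0 ->
  (forall y, `|y - x| <= d0 -> `|iter q G y - iter q G x| <= l * `|y - x|) ->
  attracting_point G x.
Proof.
move=> q0 G1 Gx L1 GL /andP[l0 l1] d00 Gc; have L0 : 0 < L by lra.
have Ln n y z : `|iter n G y - iter n G z| <= L ^+ n * `|y - z|.
  elim: n => [|n IH]; first by rewrite mul1r.
  by rewrite exprS -mulrA; apply: le_trans (GL _ _) _; rewrite ler_pM2l.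
have cs s y : `|y - x| <= d0 ->
    `|iter (s * q) G y - iter (s * q) G x| <= l ^+ s * `|y - x|.
  move=> yx; elim: s => [|s IH]; first by rewrite mul1r.
  move: IH; rewrite !(iter_periodic_orbit G1 Gx) mulSn iterD.
  set y' := iter (s * q) G y => IH.
  (* Undoing [s] turns brings the orbit of [y] back into the [d0]-neighbourhood of [x], where [Gc]
     applies again. *)
  have := iter_shift G1 q (- s%:Z) y'; rewrite mulrNz -pmulrn mulNr => E.
  have yE : y' - s%:R * (2 * pi) - x = y' - (x + s%:R * (2 * pi)) by lra.
  have := Gc (y' - s%:R * (2 * pi)); rewrite E Gx yE.
  have -> : iter q G y' - s%:R * (2 * pi) - (x + 2 * pi) =
      iter q G y' - (x + s.+1%:R * (2 * pi)).
    by rewrite -[s.+1%:R]nat1r [(1 + _) * _]mulrDl mul1r; lra.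
  move=> H; apply: le_trans (H _) _.
    apply: le_trans IH _; apply: le_trans yx.
    by rewrite ler_piMl// exprn_ile1// ltW.
  by rewrite exprS -mulrA ler_wpM2l.
have cn n y : `|y - x| <= d0 ->
    `|iter n G y - iter n G x| <= L ^+ q * l ^+ (n %/ q) * `|y - x|.
  move=> yx; rewrite {1 2}(divn_eq n q) addnC !iterD.
  apply: le_trans (Ln _ _ _) _; rewrite -mulrA.
  apply: ler_pM => //; [by rewrite exprn_ge0// ltW| |exact: cs].
  by rewrite ler_weXn2l// ltnW// ltn_pmod.
have dn n y (m : int) : dist_circle (iter n G y) (iter n G x) <=
    `|iter n G (y + m%:~R * (2 * pi)) - iter n G x|.
  by apply: le_trans (dist_circle_le _ _ m) _; rewrite (iter_shift G1) addrAC.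
split=> [e e0|].
  exists (Num.min d0 (e / L ^+ q));
    first by rewrite lt_min d00 divr_gt0 ?exprn_gt0.
  move=> y /dist_circle_lt[m]; rewrite lt_min ltr_pdivlMr ?exprn_gt0//.
  move=> /andP[/ltW yd ye] n; apply: le_lt_trans (dn n y m) _.
  apply: le_lt_trans (cn n _ yd) _; apply: le_lt_trans ye.
  rewrite [leRHS]mulrC ler_wpM2r// ler_piMr ?exprn_ge0// ?(ltW L0)//.
  by rewrite exprn_ile1// ltW.
exists d0 => // y /dist_circle_lt[m /ltW yd].
apply/cvgrPdist_lt => e e0.
have c0 : L ^+ q * l ^+ s * d0 @[s --> \oo] --> (0 : R).
  rewrite -[0 : R](mul0r d0) -(mulr0 (L ^+ q)).
  apply: cvgM; last exact: cvg_cst.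
  apply: cvgM; first exact: cvg_cst.
  by apply: cvg_expr; rewrite ger0_norm.
move/cvgrPdist_lt : c0 => /(_ e e0)[S _ HS].
near=> n; rewrite sub0r normrN ger0_norm ?dist_circle_ge0//.
apply: le_lt_trans (dn n y m) _; apply: le_lt_trans (cn n _ yd) _.
have := HS (n %/ q)%N; rewrite /= sub0r normrN => H.
apply: le_lt_trans (H _); last first.
  by rewrite leq_divRL//; near: n; exact: nbhs_infty_ge.
apply: le_trans (ler_norm _).
by rewrite ler_wpM2l// mulr_ge0// exprn_ge0// ltW.
Unshelve. all: by end_near.
Qed.

End CircleLifts.

(** * Orbits of a perturbed rotation of order q *)

Section PerturbedRotation.
Context {R : realType} (w dw : R -> R) (A0 A1 : R) (q : nat).
Context (wp : periodic w (2 * pi)).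
Context (wd : forall z, is_derive z (1 : R) w (dw z)).
Context (wA0 : forall z, `|w z| <= A0).
Context (dwA1 : forall z, `|dw z| <= A1).
Context (q0 : (0 < q)%N).
Implicit Types (a x y : R) (n : nat).

(** A member of the rotation family: the part of the rotation parameter proportional to [a] is
    absorbed into [w] as a constant. *)
Let F a x := x + angle q + a * w x.

Lemma step_shift a x : F a (x + 2 * pi) = F a x + 2 * pi.
Proof. by rewrite /F wp; lra. Qed.

Lemma step_lipschitz a y z : 0 <= a -> `|F a y - F a z| <= (1 + a * A1) * `|y -
  z|.
Proof.
move=> a0; have -> : F a y - F a z = (y - z) + a * (w y - w z).
  by rewrite /F; lra.
apply: le_trans (ler_normD _ _) _.
rewrite mulrDl mul1r lerD2l normrM ger0_norm// -mulrA ler_wpM2l//.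
exact: derive_lipschitz wd dwA1 _ _.
Qed.

Lemma step_homo a : 0 <= a -> a * A1 <= 1 -> {homo F a : x y / x <= y}.
Proof.
move=> a0 aA x y xy; rewrite -subr_ge0.
have -> : F a y - F a x = (y - x) + a * (w y - w x) by rewrite /F; lra.
have := derive_lipschitz wd dwA1 y x;
  rewrite [`|y - x|]ger0_norm ?subr_ge0// => H.
have {H} : a * `|w y - w x| <= a * A1 * (y - x) by rewrite -mulrA ler_wpM2l.
have : a * A1 * (y - x) <= y - x by rewrite ler_piMl// subr_ge0.
have : - (a * `|w y - w x|) <= a * (w y - w x).
  by rewrite -mulrN ler_wpM2l// lerNl -normrN ler_norm.
by lra.
Qed.

Lemma iter_stepE a n x :
  iter n (F a) x = x + n%:R * angle q + a * \sum_(j < n) w (iter j (F a) x).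
Proof.
elim: n => [|n IH]; first by rewrite big_ord0 mulr0 mul0r !addr0.
by rewrite big_ord_recr iterS {1}/F {1}IH -natr1 mulrDr; lra.
Qed.

Lemma iter_step_drift a n x : 0 <= a -> (n <= q)%N ->
  `|iter n (F a) x - (x + n%:R * angle q)| <= a * (q%:R * A0).
Proof.
move=> a0 nq; rewrite iter_stepE addrC addKr normrM ger0_norm// ler_wpM2l//.
apply: le_trans (ler_norm_sum _ _ _) _.
apply: le_trans (ler_sum _ (fun j _ => wA0 _)) _.
rewrite sumr_const card_ord -[A0 *+ n]mulr_natl ler_wpM2r ?ler_nat//.
exact: le_trans (wA0 0).
Qed.

Lemma continuous_iter_step a n : continuous (iter n (F a)).
Proof.
have cw : continuous w.
  move=> z; apply: differentiable_continuous.
  by apply/derivable1_diffP; case: (wd z).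
elim: n => [|n IH] x; first exact: cvg_id.
apply: (@continuous_comp _ _ _ (iter n (F a)) (F a)); first exact: IH.
apply: cvgD; first by apply: cvgD; [exact: cvg_id|exact: cvg_cst].
by apply: cvgM; [exact: cvg_cst|exact: cw].
Qed.

(* By the mean value theorem the increments along two orbits are multiplied by
   [1 + a * dw (xi j)] with [xi j] close to [x + j%:R * angle q], and
   [1 + t <= expR t]. *)
Lemma iter_step_contraction a x y (kappa e : R) : 0 <= a -> a * A1 <= 1 ->
  (forall z z', `|z - z'| <= e -> `|dw z - dw z'| <= kappa / q%:R) ->
  rot_sum q dw x <= - (2 * kappa) ->
  `|y - x| + 3 * (a * (q%:R * A0)) <= e ->
  `|iter q (F a) y - iter q (F a) x| <= expR (- (a * kappa)) * `|y - x|.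
Proof.
move=> a0 aA dwc Sx ye.
have /choice[xi xiP] j : exists c,
    `|c - iter j (F a) x| <= `|iter j (F a) y - iter j (F a) x| /\
    w (iter j (F a) y) - w (iter j (F a) x) =
      dw c * (iter j (F a) y - iter j (F a) x).
  by have [c] := MVT_unordered (iter j (F a) y) (iter j (F a) x) wd; exists c.
have H n : `|iter n (F a) y - iter n (F a) x| <=
    expR (a * \sum_(j < n) dw (xi j)) * `|y - x|.
  elim: n => [|n IH]; first by rewrite big_ord0 mulr0 expR0 mul1r.
  have -> : iter n.+1 (F a) y - iter n.+1 (F a) x =
      (1 + a * dw (xi n)) * (iter n (F a) y - iter n (F a) x).
    rewrite [RHS]mulrDl mul1r -mulrA -(xiP n).2 !iterS {1 3}/F.
    by lra.
  rewrite big_ord_recr /= [a * (_ + _)]mulrDr expRD [expR _ * expR _]mulrC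
    -mulrA normrM.
  (* The assumption [a * A1 <= 1] makes the factor nonnegative, so the exponential bounds its
     absolute value. *)
  apply: ler_pM => //; rewrite ger0_norm ?expR_ge1Dx//.
  have : a * - A1 <= a * dw (xi n).
    by rewrite ler_wpM2l// lerNl; apply: le_trans (dwA1 (xi n));
      rewrite -normrN ler_norm.
  by lra.
apply: le_trans (H q) _; rewrite ler_wpM2r// ler_expR -mulrN ler_wpM2l//.
have q0R : 0 < q%:R :> R by rewrite ltr0n.
(* Moving the points [xi j] to the rigid orbit costs at most [kappa] of the available
   [2 * kappa]. *)
have : \sum_(j < q) (dw (xi j) - dw (x + j%:R * angle q)) <= kappa.
  have -> : kappa = \sum_(j < q) (kappa / q%:R).
    by rewrite sumr_const card_ord -[(kappa / _) *+ q]mulr_natl mulrC divfK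
      ?gt_eqF.
  apply: ler_sum => j _; apply: le_trans (ler_norm _) _; apply: dwc.
  have jq := ltnW (ltn_ord j).
  have := iter_step_drift x a0 jq; have := iter_step_drift y a0 jq.
  have := (xiP j).1; set X := iter j _ x; set Y := iter j _ y.
  set t := j%:R * _; set D := a * (_ * _) in ye *.
  (* Three drifts occur: two in comparing [Y - X] with [y - x], and one between [X] and [x + t]. *)
  have -> : Y - X = (Y - (y + t)) - (X - (x + t)) + (y - x) by ring.
  have -> : xi j - (x + t) = (xi j - X) + (X - (x + t)) by ring.
  move=> xX yD xD; apply: le_trans (ler_normD _ _) _.
  have := ler_normD (Y - (y + t) - (X - (x + t))) (y - x).
  have := ler_normB (Y - (y + t)) (X - (x + t)).
  by lra.
by rewrite sumrB -/(rot_sum q dw x); lra.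
Qed.

(** Beyond [2 * pi], the [q]-th iterate moves [x] by [a * Psi x], where [Psi] sums [w] along the
    true orbit and is within [sigma] of the rotation sum. Hence [Psi] changes sign between [u] and
    [v], and at its zero the rotation sum is at most [sigma] in absolute value. *)
Lemma iter_step_fixed a u v (sigma : R) : 0 < a -> u <= v ->
  (forall z z', `|z - z'| <= a * (q%:R * A0) -> `|w z - w z'| <= sigma / q%:R)
    ->
  sigma <= rot_sum q w u -> rot_sum q w v <= - sigma ->
  exists x, [/\ u <= x <= v, iter q (F a) x = x + 2 * pi &
    `|rot_sum q w x| <= sigma].
Proof.
move=> a0 uv wc Su Sv; have q0R : 0 < q%:R :> R by rewrite ltr0n.
pose Psi x := \sum_(j < q) w (iter j (F a) x).
have PsiS x : `|Psi x - rot_sum q w x| <= sigma.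
  rewrite /Psi /rot_sum -sumrB; apply: le_trans (ler_norm_sum _ _ _) _.
  have -> : sigma = \sum_(j < q) (sigma / q%:R).
    by rewrite sumr_const card_ord -[(sigma / _) *+ q]mulr_natl mulrC divfK
      ?gt_eqF.
  apply: ler_sum => j _; apply: wc.
  exact: iter_step_drift (ltW a0) (ltnW (ltn_ord j)).
have PsiE x : iter q (F a) x = x + 2 * pi + a * Psi x.
  by rewrite iter_stepE mul_angle.
have PsiC : continuous (fun x => a * Psi x).
  have -> : (fun x => a * Psi x) = (fun x => iter q (F a) x - x - 2 * pi).
    by apply/funext => x; rewrite PsiE; ring.
  move=> x; apply: cvgB; last exact: cvg_cst.
  by apply: cvgB; [exact: continuous_iter_step|exact: cvg_id].
have [|x xuv xP] := @IVT _ _ u v 0 uv (continuous_subspaceT PsiC).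
  have := PsiS u; have := PsiS v; rewrite !ler_norml => /andP[_ v1] /andP[u1 _].
  rewrite ge_min le_max !pmulr_rge0// !pmulr_rle0//.
  by apply/andP; split; apply/orP; [right|left]; lra.
have {}xP : Psi x = 0 by apply/eqP; move/eqP: xP; rewrite mulf_eq0 (gt_eqF a0).
exists x; split; first by rewrite in_itv in xuv.
  by rewrite PsiE xP mulr0 addr0.
by have := PsiS x; rewrite xP sub0r normrN.
Qed.

End PerturbedRotation.

(** * From descending zeros of rotation sums to cyclicity bounds *)

Section Cyclicity.
Context {R : realType}.

(** Each interval [[u i, v i]] yields a periodic point; the slope condition where the sum is small
    makes it attracting, and separation modulo [angle q] keeps the orbits distinct. *)
Lemma nb_attracting_perturbed_rotation (w dw : R -> R) (q m : nat)
    (u v : 'I_m -> R) (sigma kappa d0 : R) :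
  periodic w (2 * pi) -> periodic dw (2 * pi) -> continuous dw ->
  (forall z, is_derive z (1 : R) w (dw z)) ->
  (0 < q)%N -> (0 < m)%N -> 0 < sigma -> 0 < kappa -> 0 < d0 ->
  (forall i, u i <= v i) ->
  (forall i, sigma <= rot_sum q w (u i)) ->
  (forall i, rot_sum q w (v i) <= - sigma) ->
  (forall i x, u i <= x <= v i -> `|rot_sum q w x| <= sigma ->
    rot_sum q dw x <= - (2 * kappa)) ->
  (forall i j x y (z : int), u i <= x <= v i -> u j <= y <= v j -> i != j ->
    d0 <= `|y - x - z%:~R * angle q|) ->
  exists2 a0 : R, 0 < a0 & forall a, 0 < a < a0 ->
    rotation_number (fun x => x + angle q + a * w x) = q%:R^-1 /\
    ((m%:R : R)%:E <= nb_attracting (fun x => x + angle q + a * w x)%R)%E.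
Proof.
move=> wp dwp dwc wd q0 m0 s0 k0 d00 uv Su Sv Sd sep.
have q0R : 0 < q%:R :> R by rewrite ltr0n.
have wc : continuous w.
  move=> z; apply: differentiable_continuous.
  by apply/derivable1_diffP; case: (wd z).
have [A0' A0'P] := periodic_bounded wp wc.
have [A1' A1'P] := periodic_bounded dwp dwc.
pose A0 := Num.max 1 A0'; pose A1 := Num.max 1 A1'.
have A0P z : `|w z| <= A0 by rewrite le_max A0'P orbT.
have A1P z : `|dw z| <= A1 by rewrite le_max A1'P orbT.
have A0_gt0 : 0 < A0 by rewrite lt_max ltr01.
have A1_gt0 : 0 < A1 by rewrite lt_max ltr01.
have [d1 d10 d1P] := periodic_unif_continuous (@twopi_gt0 R) wp wc
  (divr_gt0 s0 q0R).
have [d2 d20 d2P] := periodic_unif_continuous (@twopi_gt0 R) dwp dwc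
  (divr_gt0 k0 q0R).
have qA0 : 0 < q%:R * A0 by rewrite mulr_gt0.
(* For the chosen [a] the drift is below [D]. Contraction on the [D]-neighbourhood then needs
   closeness [4 * D = D + 3 * D], and 6 leaves room for strict inequalities. *)
pose D := Num.min d0 (Num.min d1 d2) / 6.
have D0 : 0 < D by rewrite divr_gt0// !lt_min d00 d10 d20.
have /and3P[Dd0 Dd1 Dd2] : [&& 6 * D <= d0, 6 * D <= d1 & 6 * D <= d2].
  by rewrite /D mulrC divfK// !ge_min !lexx !orbT.
exists (Num.min A1^-1 (D / (q%:R * A0))).
  by rewrite lt_min invr_gt0 A1_gt0 divr_gt0.
move=> a /andP[a0]; rewrite lt_min => /andP[aA1]; rewrite ltr_pdivlMr// => aD.
have {}aA1 : a * A1 <= 1 by rewrite -ler_pdivlMr// mul1r ltW.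
set G := fun x => _.
have G1 x : G (x + 2 * pi) = G x + 2 * pi by exact: step_shift.
have /choice[x xP] i : exists x, [/\ u i <= x <= v i, iter q G x = x + 2 * pi &
    `|rot_sum q w x| <= sigma].
  apply: (iter_step_fixed wd A0P q0 a0 (uv i) _ (Su i) (Sv i)) => z z' zz'.
  by apply: ltW; apply: d1P; lra.
split.
  have [_ xx _] := xP (Ordinal m0).
  apply: (rotation_numberE q0 _ G1 xx).
  exact: (step_homo q wd A1P (ltW a0) aA1).
apply: (@counting_ge _ _ _ _ (fun i => trajectory G (x i))) => [i j|i];
  last first.
  have [xi xx xS] := xP i.
  exists (x i) => //; split; first by exists q => //; exists 1;
    rewrite xx mul1r.
  apply: (@contraction_attracting _ _ q _ (1 + a * A1) (expR (- (a * kappa)))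
    D) => //.
  - by rewrite lerDl mulr_ge0// ltW.
  - by move=> y z; exact: (step_lipschitz q wd A1P y z (ltW a0)).
  - by rewrite expR_ge0 expR_lt1 oppr_lt0 mulr_gt0.
  - move=> y yx; apply: (iter_step_contraction wd A0P A1P q0 (e := 4 * D)) =>
    //.
    + exact: ltW.
    + by move=> z z' zz'; apply: ltW; apply: d2P; lra.
    + exact: Sd xi xS.
    + by lra.
(* If two trajectories coincide, [x j] lies on the orbit of [x i], hence within one drift of a
   translate of [x i] by a multiple of [angle q], against [sep]. *)
move=> tij; apply/eqP/negPn/negP => ij.
have [xi xx _] := xP i; have [xj _ _] := xP j.
have : trajectory G (x i) (x j).
  by rewrite tij; exists 0%N, 0; rewrite mul0r addr0.
move=> [n [k E]]; have := sep i j _ _ (n%:Z + k * q%:Z) xi xj ij.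
have : `|iter n G (x i) - (x i + n%:R * angle q)| <= a * (q%:R * A0).
  apply: iter_drift_le => // l lq.
  exact: (iter_step_drift A0P _ (ltW a0) (ltnW lq)).
have -> : x j - x i - (n%:Z + k * q%:Z)%:~R * angle q =
    iter n G (x i) - (x i + n%:R * angle q).
  by rewrite E intrD intrM -!pmulrn -(mul_angle q0); ring.
by lra.
Qed.

(** Every right neighbourhood of 0 contains some [b <= a0], and the parameter [b / 2] takes part in
    the supremum at [a1 = b]. *)
Lemma cyclicity_bound_ge (f : R -> R) (rho a0 : R) (M : \bar R) : 0 < a0 ->
  (forall a, 0 < a < a0 -> exists2 r, rotation_number (rot_family f r a) = rho &
    (M <= nb_attracting (rot_family f r a))%E) ->
  (M <= cyclicity_bound f rho)%E.
Proof.
move=> a00 H; apply: le_ereal_inf_tmp => _ [V [d /= d0 dV] <-].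
pose b := Num.min (d / 2) a0.
have b0 : 0 < b by rewrite lt_min a00 divr_gt0.
have ba0 : b <= a0 by rewrite ge_min lexx orbT.
have bd : b <= d / 2 by rewrite ge_min lexx.
have Vb : V b.
  by apply: dV => //=; rewrite sub0r normrN gtr0_norm//; lra.
apply: le_trans (ereal_sup_ubound _); last by exists b.
have [|r rE Mr] := H (b / 2); first by lra.
apply: le_trans Mr _; apply: ereal_sup_ubound; exists (r, b / 2) => //=.
by split=> //; rewrite gtr0_norm; lra.
Qed.

End Cyclicity.

(** * Cyclicity created by a sine wave, and porosity *)

Section Porosity.
Context {R : realType}.

Lemma cosDint2pi (x : R) (m : int) : cos (x + m%:~R * (2 * pi)) = cos x.
Proof. by apply: periodic_int => y; rewrite mulr_natl cosD2pi. Qed.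

(** The rotation sum of the wave has [m] descending zeros per period [angle q]. They survive because
    [W] contributes an oscillation of at most a quarter of the amplitude [q%:R * delta]. *)
Lemma cyclicity_bound_sine_wave k (W : R -> R) (q m : nat) (delta B : R) :
  (0 < k)%N -> (0 < q)%N -> (0 < m)%N -> 0 < delta -> is_Ck_circle k W ->
  (forall z, `|rot_sum q (derive1n k W) z| <= B) ->
  angle q ^+ k * B <= q%:R * delta / 4 ->
  ((m%:R : R)%:E <=
   cyclicity_bound (fun x => sine_wave delta (q * m) x + W x)%R q%:R^-1)%E.
Proof.
move=> k0 q0 m0 delta0 cW WB Bd; set h := sine_wave delta (q * m).
set T := fun x => _.
have q0R : 0 < q%:R :> R by rewrite ltr0n.
have m0R : 0 < m%:R :> R by rewrite ltr0n.
have a0 := @angle_gt0 R _ q0; have pi0 := @pi_gt0 R.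
pose N : R := (q * m)%:R.
have N0 : 0 < N by rewrite ltr0n muln_gt0 q0.
have ch : is_Ck_circle k h by exact: is_Ck_sine_wave.
have TE : T = fun x => 1 * h x + W x.
  by apply/funext => x; rewrite mul1r.
have cT : is_Ck_circle k T by rewrite TE; exact: is_Ck_circle_lin.
have T1 : derive1n 1 T = fun x => derive1n 1 h x + derive1n 1 W x.
  rewrite TE (derive1n_lin 1 ch cW k0).
  by apply/funext => x; rewrite mul1r.
(* This constant cancels the sum of [W] at 0, leaving only its oscillation to control. *)
pose b := - rot_sum q W 0 / q%:R.
pose w x := T x + b; pose dw := derive1n 1 T.
have [pT dT _] := cT.
have wd z : is_derive z (1 : R) w (dw z).
  have Td : is_derive z (1 : R) T (dw z).
    by rewrite /dw derive1n1 derive1E; apply/derivableP; exact: (dT 0 z k0).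
  by apply: is_derive_eq; rewrite addr0.
have Sh x : rot_sum q h x = q%:R * delta * sin (N * x).
  have := rot_sum_sine m delta 0 x q0; rewrite addr0 => <-.
  by apply: eq_bigr => j _; rewrite addr0.
have Sw x : rot_sum q w x =
    q%:R * delta * sin (N * x) + (rot_sum q W x - rot_sum q W 0).
  rewrite /w rot_sumD rot_sumD Sh -addrA; congr (_ + (_ + _)).
  rewrite /rot_sum sumr_const card_ord -[b *+ q]mulr_natl mulrC.
  by rewrite divfK ?gt_eqF.
have Sdw x : rot_sum q dw x =
    q%:R * (delta * N) * cos (N * x) + rot_sum q (derive1n 1 W) x.
  rewrite /dw T1 rot_sumD; congr (_ + _).
  rewrite derive1n_sine_wave expr1 mul1r rot_sum_sine// sinDpihalf.
  by [].
pose sigma := q%:R * delta / 4.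
have s0 : 0 < sigma by rewrite divr_gt0// mulr_gt0.
have WS x : `|rot_sum q W x - rot_sum q W 0| <= sigma.
  by apply: le_trans Bd; exact: rot_sum_osc_le.
(* Dividing [sigma] by [angle q] gives [kappa / pi], which bounds the slope due to [W]. The wave has
   slope at most [- (4 * kappa)] where its cosine is at most -1/2, so [- (2 * kappa)] is safe. *)
pose kappa := q%:R ^+ 2 * delta / 8.
have kap0 : 0 < kappa by rewrite divr_gt0// mulr_gt0// exprn_gt0.
have WS1 x : `|rot_sum q (derive1n 1 W) x| <= kappa.
  apply: le_trans (rot_sum_derive1n_le q0 cW WB _ _) _; first by rewrite k0.
  have := Bd; rewrite -(prednK k0) exprS -mulrA subn1 mulrC => BB.
  have {BB} := BB; rewrite -ler_pdivlMr// => BB; apply: le_trans BB _.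
  have -> : q%:R * delta / 4 / angle q = kappa / pi.
    have E (s t : R) : s != 0 -> t != 0 ->
      s * delta / 4 / (2 * t / s) = s ^+ 2 * delta / 8 / t.
      by move=> sn tn; field; rewrite sn tn.
    by rewrite /angle E ?gt_eqF.
  by rewrite ler_pdivrMr// ler_peMr ?(ltW kap0)//; have := @pi_ge2 R; lra.
(* The phases at which the sine descends through zero; [[u i, v i]] is the quarter turn on either
   side. *)
pose c (i : 'I_m) : R := pi + i%:R * (2 * pi).
pose u i := (c i - pi / 2) / N; pose v i := (c i + pi / 2) / N.
have uvE i x : (u i <= x <= v i) = (- (pi / 2) <= N * x - c i <= pi / 2).
  rewrite /u /v ler_pdivrMr// ler_pdivlMr// [x * N]mulrC.
  by apply/idP/idP => /andP[? ?]; apply/andP; split; lra.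
have NuE i : N * u i = pi / 2 + (Posz i)%:~R * (2 * pi).
  by rewrite /u mulrC divfK ?gt_eqF// /c -pmulrn; lra.
have NvE i : N * v i = pi / 2 + pi + (Posz i)%:~R * (2 * pi).
  by rewrite /v mulrC divfK ?gt_eqF// /c -pmulrn; lra.
have [||||i|i|i|i x|i j x y z|a1 a10 Ha1] := @nb_attracting_perturbed_rotation R
    w dw q m u v sigma (kappa) (pi / N) _ _ _ wd q0 m0 s0 kap0 _ _ _ _ _ _.
- by move=> x; rewrite /w pT.
- exact: periodic_derive1n.
- exact: Ck_circle_continuous cT k0.
- by rewrite divr_gt0.
- by rewrite /u /v ler_pM2r ?invr_gt0//; lra.
- rewrite Sw NuE sinDint2pi sin_pihalf mulr1.
  by have := WS (u i); rewrite ler_norml /sigma; lra.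
- rewrite Sw NvE sinDint2pi sinDpi sin_pihalf.
  by have := WS (v i); rewrite ler_norml /sigma; lra.
- rewrite uvE Sw Sdw => xc Sx.
  have qd0 : 0 < q%:R * delta by rewrite mulr_gt0.
  (* The total and the error are each at most [sigma], a quarter of the amplitude, hence the
     half. *)
  have sx : `|sin (N * x)| <= 2^-1.
    rewrite -(ler_pM2l qd0) -[X in X * `|_|]gtr0_norm// -normrM.
    have := ler_normB (q%:R * delta * sin (N * x) +
      (rot_sum q W x - rot_sum q W 0)) (rot_sum q W x - rot_sum q W 0).
    by rewrite addrK; have := WS x; move: Sx; rewrite /sigma; lra.
  have cx : cos (N * x) <= 0.
    have -> : N * x = N * x - c i + pi + (Posz i)%:~R * (2 * pi).
      by rewrite /c -pmulrn; lra.
    by rewrite cosDint2pi cosDpi oppr_le0 cos_ge0_pihalf.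
  have {cx} cx : cos (N * x) <= - 2^-1.
    have := cos2Dsin2 (N * x); rewrite -[sin _ ^+ 2]real_normK ?num_real//.
    have : 0 <= `|sin (N * x)| by [].
    by nra.
  have := WS1 x; rewrite ler_norml => /andP[_ W1].
  have : q%:R * (delta * N) * cos (N * x) <= q%:R * (delta * N) * - 2^-1.
    by rewrite ler_wpM2l// !mulr_ge0// ltW.
  have : q%:R * (delta * q%:R) <= q%:R * (delta * N).
    rewrite !ler_wpM2l// ?(ltW delta0)// /N natrM ler_peMr//.
    by rewrite (ler_nat _ 1).
  by move: W1 kap0; rewrite /kappa expr2; lra.
- rewrite !uvE => xc yc ij.
  rewrite ler_pdivrMr// mulrC -[X in X * `|_|]gtr0_norm// -normrM.
  (* A shift by [angle q] is [m] full turns of phase. As [i] and [j] are distinct modulo [m], [K] is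
     nonzero and the phases differ by at least [2 * pi - pi]. *)
  pose K : int := Posz j - Posz i - z * Posz m.
  have -> : N * (y - x - z%:~R * angle q) =
      (N * y - c j) - (N * x - c i) + K%:~R * (2 * pi).
    by rewrite /K !intrB intrM -!pmulrn /c /N natrM -(mul_angle q0); ring.
  have K0 : 1 <= `|K%:~R| :> R.
    rewrite -intr_norm ler1z -gtz0_ge1 normr_gt0; apply: contraNneq ij => /eqP.
    rewrite /K subr_eq0 subr_eq => /eqP jE; apply/eqP/val_inj => /=.
    have := modz_small (m := Posz j) (d := Posz m).
    rewrite jE modzMDl modz_small ?lez_nat/= ?ltz_nat//.
    by rewrite -jE => /(_ (ltn_ord j)) [].
  have := lerB_normD (K%:~R * (2 * pi)) (N * y - c j - (N * x - c i)).
  rewrite [X in _ <= `|X|]addrC normrM [`|2 * pi|]gtr0_norm ?twopi_gt0//.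
  have : 1 * (2 * pi) <= `|K%:~R| * (2 * pi) :> R.
    by rewrite ler_wpM2r// ltW// twopi_gt0.
  have : `|N * y - c j - (N * x - c i)| <= pi by rewrite ler_norml; lra.
  by lra.
apply: (cyclicity_bound_ge a10) => a aa; have [r1 r2] := Ha1 a aa.
have E : rot_family T (q%:R^-1 + a * b / (2 * pi)) a =
    (fun x => x + angle q + a * w x).
  apply/funext => x; rewrite /rot_family /w /angle.
  have E (s t : R) : s != 0 -> t != 0 ->
      x + 2 * t * (s^-1 + a * b / (2 * t)) + a * T x =
      x + 2 * t / s + a * (T x + b).
    by move=> sn tn; field; rewrite sn tn.
  by rewrite E ?gt_eqF.
by exists (q%:R^-1 + a * b / (2 * pi)); rewrite E.
Qed.

(** The centre [y] is [f] plus a wave of frequency [q * m]. The ratio [c] is fixed before [f] and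
    [e]; only [q] and the amplitude depend on them. *)
Lemma exists_cyclic_ball k m : (0 < k)%N -> (0 < m)%N ->
  exists2 c : R, 0 < c & forall (f : Ck R k) (e : R), 0 < e ->
    exists2 y : Ck R k, 0 < `|y - f| < e & exists rho : R,
      forall g, ball y (c * `|y - f|) g ->
        ((m%:R : R)%:E <= cyclicity_bound g rho)%E.
Proof.
move=> k0 m0; have m0R : 0 < m%:R :> R by rewrite ltr0n.
have P0 := @twopi_gt0 R.
(* Solves [angle q ^+ k * (q%:R * (2 * (c * e'))) = q%:R * delta / 4] for
   [delta = e' / (q * m) ^ k]; the powers of [q] cancel. *)
pose c : R := (8 * (2 * pi * m%:R) ^+ k)^-1.
have c0 : 0 < c by rewrite invr_gt0 mulr_gt0// exprn_gt0// mulr_gt0.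
exists c => // f e e0; pose e' := e / 2.
have e'0 : 0 < e' by rewrite divr_gt0.
have ce0 : 0 < c * e' by rewrite mulr_gt0.
have [pf df kf] := CkP f.
have [d d0 fd] := periodic_unif_continuous P0 (periodic_derive1n k pf) kf ce0.
(* Large enough that the [k]-th derivative of [f] varies by less than [c * e'] over one rotation
   step. *)
pose q := (Num.truncn (2 * pi / d)).+1.
have q0R : 0 < q%:R :> R by rewrite ltr0n.
have qd : angle q < d.
  by rewrite /angle ltr_pdivrMr// [d * _]mulrC -ltr_pdivrMr//;
    exact: truncnS_gt.
pose N : R := (q * m)%:R.
have N0 : 0 < N by rewrite ltr0n muln_gt0.
pose delta := e' / N ^+ k.
have delta0 : 0 < delta by rewrite divr_gt0// exprn_gt0.
have hP : sine_wave delta (q * m) \in Ck_circle R k.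
  by rewrite inE; exact: is_Ck_sine_wave.
pose h : Ck R k := CkSub hP.
have he : `|h| <= e'.
  apply: Ck_norm_le => [|i x ik]; first exact: ltW.
  apply: le_trans (derive1n_sine_wave_le _ _ _ (ltW delta0)) _.
  rewrite /delta -mulrA ler_piMr ?(ltW e'0)// mulrC ler_pdivrMr ?exprn_gt0//
    mul1r.
  by rewrite ler_weXn2l// ler1n muln_gt0.
have h0 : 0 < `|h|.
  apply: lt_le_trans (le_Ck_norm h (pi / 2 / N) (leq0n k)).
  by rewrite /= /sine_wave [N * _]mulrC divfK ?gt_eqF// sin_pihalf mulr1
    normr_gt0 gt_eqF.
have yf : f + h - f = h by rewrite addrC addKr.
exists (f + h); first by rewrite yf h0; apply: le_lt_trans he _; rewrite /e';
  lra.
exists q%:R^-1 => g; rewrite yf -ball_normE /= => gy.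
pose W : Ck R k := g - h.
have gE : (g : R -> R) = fun x => sine_wave delta (q * m) x + W x.
  by apply/funext => x; rewrite /W /=; rewrite addrC subrK.
rewrite gE.
apply: (@cyclicity_bound_sine_wave k _ _ _ _ (q%:R * (2 * (c * e')))) => //.
- exact: CkP.
(* Both parts of [W] contribute [q%:R * (c * e')]: [f] by cancellation along the rotation, the rest
   because its norm is below [c * e']. *)
- have WE : W = f + (g - (f + h)) by rewrite /W opprD addrCA addNKr.
  move=> z; rewrite WE derive1n_CkD// rot_sumD.
  have -> : q%:R * (2 * (c * e')) = q%:R * (c * e') + q%:R * (c * e') by ring.
  apply: le_trans (ler_normD _ _) _; apply: lerD.
    apply: (@rot_sum_derive_le _ _ (derive1n k.-1 f)) => //.
    + exact: periodic_derive1n.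
    + have kE (F : R -> R) : derive1n k F = derive1 (derive1n k.-1 F).
        by rewrite -derive1nS prednK.
      move=> x; rewrite kE derive1E.
      by apply/derivableP; apply: df; rewrite ltn_predL.
    + by move=> x y xy; apply/ltW/fd; exact: le_lt_trans qd.
  apply: rot_sum_le => x; apply: le_trans (le_Ck_norm _ _ (leqnn k)) _.
  change (`|g - (f + h)| <= c * e'); rewrite distrC; apply: (le_trans (ltW gy)).
  by rewrite ler_pM2l.
- rewrite /angle /c /delta /N natrM expr_div_n !exprMn.
  have E (s t u v : R) : s != 0 -> t != 0 -> u != 0 -> v != 0 ->
      s * t / u * (q%:R * (2 * ((8 * (s * t * v))^-1 * e'))) =
      q%:R * (e' / (u * v)) / 4.
    by move=> *; field; do ?[apply/andP; split].
  by rewrite E ?expf_neq0// ?gt_eqF// pi_gt0.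
Qed.

End Porosity.

Theorem theorem6 (R : realType) (k : nat) (hk : (2 <= k)%N) :
  sigma_porous (IC_fin R k).
Proof.
exists (fun n => [set f : Ck R k | forall rho,
    (cyclicity_bound f rho <= (n%:R : R)%:E)%E]).
  move=> n f _.
  (* With [n.+1] attracting orbits, every function in the ball exceeds the bound [n] at the rotation
     number [rho]. *)
  have [c c0 H] := @exists_cyclic_ball R k n.+1 (ltnW hk) (ltn0Sn n).
  exists c => // e e0; have [y ye [rho yP]] := H f e e0.
  exists y; split => //; rewrite -subset0 => g [gy /(_ rho)] /=.
  apply/negP; rewrite -ltNge; apply: lt_le_trans (yP g gy).
  by rewrite lte_fin ltr_nat.
apply/seteqP; split => f /=.
  move=> [M fM]; exists (Num.truncn `|M|).+1 => // rho.
  apply: le_trans (fM rho) _; rewrite lee_fin.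
  by apply: le_trans (ler_norm M) _; rewrite ltW// truncnS_gt.
by move=> [n _ fn]; exists n%:R.
Qed.
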